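(* Let $\Sigma$ and $\Gamma$ be finite alphabets. (i) For every well-defined order-preserving BMRS interpretation $\pi : \Sigma \times m \to \Gamma$, the transduction $[\![\pi]\!] : \Gamma^\star \to \Sigma^\star$ is a rational function. (ii) Conversely, for every rational function $f$ there is an order-preserving BMRS interpretation $\pi$ with $f = [\![\pi]\!]$.
   Context: Strings as structures: for a finite alphabet $\Sigma$, a string $s \in \Sigma^\star$ of length $|s|$ is identified with the finite structure with domain $\{0,\dots,|s|-1\}$ (identified with $|s|$), a unary predicate $\sigma$ for each $\sigma\in\Sigma$ true exactly at indices carrying $\sigma$, unary predicates $\min$ (true only at $0$) and $\max$ (true only at $|s|-1$), and unary functions $\mathrm{S}$ ($x \mapsto x+1$ for $x<|s|-1$, $\mathrm{S}(|s|-1)=|s|-1$) and $\mathrm{P}$ ($x\mapsto x-1$ for $x>0$, $\mathrm{P}(0)=0$). Boolean monadic recursive schemes (BMRS): fix a countably infinite set of recursive function names and a single variable $\mathtt{x}$. $\Sigma$-terms have type index or boolean: $\mathtt{x}$ is an index term; if $T$ is an index term so are $\mathrm{S}(T)$ and $\mathrm{P}(T)$; $\mathtt{tt},\mathtt{ff}$ are boolean terms; for an index term $T$, $\mathtt{f}(T)$ ($\mathtt{f}$ a recursive function name), $\sigma(T)$ ($\sigma\in\Sigma$), $\max(T)$, $\min(T)$ are boolean terms; if $T_0$ is boolean and $T_1,T_2$ are both index (resp. both boolean) terms, then $\mathtt{if}\ T_0\ \mathtt{then}\ T_1\ \mathtt{else}\ T_2$ is an index (resp. boolean) term. A headless $\Sigma$-BMRS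 $p$ is a finite set of definitions $\mathtt{f}_i(\mathtt{x}) = T_i$ ($0\le i\le k$, distinct names) where each $T_i$ is a boolean $\Sigma$-term using only the recursive names $\mathtt{f}_0,\dots,\mathtt{f}_k$; such terms are called $p$-terms. For a string $s$, index $x$ and $p$-term $T$, the evaluation relation $s,x \vdash_p T \to v$ is the least relation such that: $\mathtt{x}\to x$; $\mathtt{tt}\to\top$; $\mathtt{ff}\to\bot$; if $T\to v$ then $\mathrm{S}(T)\to \min(v+1,|s|-1)$, $\mathrm{P}(T)\to\max(v-1,0)$, $\min(T)\to\top$ if $v=0$ and $\to\bot$ otherwise, $\max(T)\to\top$ if $v=|s|-1$ and $\to\bot$ otherwise, $\sigma(T)\to\top$ if index $v$ of $s$ carries $\sigma$ and $\to\bot$ otherwise; if $T\to v$ and $s,v\vdash_p T_i \to w$ then $\mathtt{f}_i(T)\to w$; if $T_0\to\top$ and $T_1\to v$ then the if-then-else term $\to v$, and if $T_0\to\bot$ and $T_2\to v$ it $\to v$. A $\Sigma$-BMRS is a headless $\Sigma$-BMRS (its body) together with a finite nonempty set of $p$-terms called heads. Interpretations: an (order-preserving, $m$-fold) BMRS interpretation $\pi:\Sigma\times m\to\Gamma$ is a $\Gamma$-BMRS with one head $\pi(\sigma,i)$ for each $\sigma\in\Sigma$ and $i<m$. It is well-defined if for each $s\in\Gamma^\star$, $i<m$, $x<|s|$, we have $s,x\vdash \pi(\sigma,i)\to\top$ for at most one $\sigma\in\Sigma$ and $s,x\vdash\pi(\tau,i)\to\bot$ for every other $\tau\in\Sigma$.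 For well-defined $\pi$, the transduction $[\![\pi]\!]:\Gamma^\star\to\Sigma^\star$ is defined as follows: for $s\in\Gamma^\star$ let $J$ be the set of $(q,r)\in |s|\times m$ such that $s,q\vdash\pi(\sigma,r)\to\top$ for some $\sigma\in\Sigma$, ordered lexicographically with $q$ the more significant coordinate; then $[\![\pi]\!](s)$ has length $|J|$ and carries $\sigma$ at position $x$ iff $s,q\vdash\pi(\sigma,r)\to\top$, where $(q,r)$ is the element of $J$ with exactly $x$ predecessors in $J$. A rational function is a (partial) function $\Gamma^\star\to\Sigma^\star$ computed by a one-way nondeterministic finite-state transducer (whose output is independent of the nondeterministic choices).
   Formalization: In (ii), f and [[π]] are shown equal at every nonempty string in the domain of f, not everywhere: [[π]] is always total and maps the empty string to itself, so f = [[π]] fails for other f; for total f fixing the empty string it is exactly f = [[π]]. *)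

(* Defs.v *)
From HB Require Import structures.
From mathcomp Require Import all_boot finmap.
From mathcomp Require Import boolp.

Set Implicit Arguments.
Unset Strict Implicit.
Unset Printing Implicit Defensive.

Local Open Scope fset_scope.
Local Open Scope fmap_scope.

(* Recursive function names are natural numbers. *)
Inductive iterm (Gamma : Type) : Type :=
| IVar
| ISucc of iterm Gamma
| IPred of iterm Gamma
| IIf of bterm Gamma & iterm Gamma & iterm Gamma
with bterm (Gamma : Type) : Type :=
| BTrue
| BFalse
| BCall of nat & iterm Gamma
| BChar of Gamma & iterm Gamma
| BMax of iterm Gamma
| BMin of iterm Gamma
| BIf of bterm Gamma & bterm Gamma & bterm Gamma.

Arguments IVar {Gamma}.
Arguments BTrue {Gamma}.
Arguments BFalse {Gamma}.
Arguments BCall {Gamma}.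

Fixpoint inames (Gamma : Type) (T : iterm Gamma) : seq nat :=
  match T with
  | IVar => [::]
  | ISucc T1 | IPred T1 => inames T1
  | IIf T0 T1 T2 => bnames T0 ++ inames T1 ++ inames T2
  end
with bnames (Gamma : Type) (T : bterm Gamma) : seq nat :=
  match T with
  | BTrue | BFalse => [::]
  | BCall f T1 => f :: inames T1
  | BChar _ T1 | BMax T1 | BMin T1 => inames T1
  | BIf T0 T1 T2 => bnames T0 ++ bnames T1 ++ bnames T2
  end.

(* The definitions f_i(x) = T_i (0 <= i <= k, so there is at least one) form a
   finite map sending the name f_i to the term T_i. *)
Record headless (Gamma : Type) := Headless {
  defs : {fmap nat -> bterm Gamma};
  defs_neq0 : domf defs != fset0;
  defs_closed : forall f T, defs.[? f] = Some T ->
    {subset bnames T <= domf defs}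
}.

Definition is_pterm (Gamma : Type) (p : headless Gamma) (T : bterm Gamma) :=
  {subset bnames T <= domf (defs p)}.

(* [ieval p s x T v] and [beval p s x T b] are the two sorts of the evaluation
   relation s, x |-_p T -> v; the index x is meant to be less than |s|. *)
Inductive ieval (Gamma : eqType) (p : headless Gamma) (s : seq Gamma) :
    nat -> iterm Gamma -> nat -> Prop :=
| ieval_var x : ieval p s x IVar x
| ieval_succ x T v :
    ieval p s x T v -> ieval p s x (ISucc T) (minn v.+1 (size s).-1)
| ieval_pred x T v :
    ieval p s x T v -> ieval p s x (IPred T) v.-1
| ieval_if_true x T0 T1 T2 v :
    beval p s x T0 true -> ieval p s x T1 v -> ieval p s x (IIf T0 T1 T2) v
| ieval_if_false x T0 T1 T2 v :
    beval p s x T0 false -> ieval p s x T2 v -> ieval p s x (IIf T0 T1 T2) v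
with beval (Gamma : eqType) (p : headless Gamma) (s : seq Gamma) :
    nat -> bterm Gamma -> bool -> Prop :=
| beval_true x : beval p s x BTrue true
| beval_false x : beval p s x BFalse false
| beval_min x T v : ieval p s x T v -> beval p s x (BMin T) (v == 0)
| beval_max x T v :
    ieval p s x T v -> beval p s x (BMax T) (v == (size s).-1)
| beval_char x a T v :
    ieval p s x T v -> beval p s x (BChar a T) (onth s v == Some a)
| beval_call x f Tf T v w :
    (defs p).[? f] = Some Tf -> ieval p s x T v -> beval p s v Tf w ->
    beval p s x (BCall f T) w
| beval_if_true x T0 T1 T2 v :
    beval p s x T0 true -> beval p s x T1 v -> beval p s x (BIf T0 T1 T2) v
| beval_if_false x T0 T1 T2 v :
    beval p s x T0 false -> beval p s x T2 v -> beval p s x (BIf T0 T1 T2) v.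

Record interpretation (Sigma Gamma : finType) (m : nat) := Interpretation {
  body : headless Gamma;
  head : Sigma -> 'I_m -> bterm Gamma;
  head_pterm : forall a i, is_pterm body (head a i)
}.

Definition evals (Sigma Gamma : finType) (m : nat)
    (pi : interpretation Sigma Gamma m) (s : seq Gamma) (x : nat)
    (a : Sigma) (i : 'I_m) (b : bool) : Prop :=
  beval (body pi) s x (head pi a i) b.

Definition well_defined (Sigma Gamma : finType) (m : nat)
    (pi : interpretation Sigma Gamma m) : Prop :=
  forall (s : seq Gamma) (i : 'I_m) (x : nat), x < size s ->
    (forall a b, evals pi s x a i true -> evals pi s x b i true -> a = b) /\
    (forall b, ~ evals pi s x b i true -> evals pi s x b i false).

(* The set J, listed in increasing lexicographic order (first coordinate most
   significant), so that the element with exactly x predecessors in J is the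
   x-th item of the list. *)
Definition live (Sigma Gamma : finType) (m : nat)
    (pi : interpretation Sigma Gamma m) (s : seq Gamma) : seq (nat * 'I_m) :=
  [seq qr <- [seq (q, r) | q <- iota 0 (size s), r <- enum 'I_m]
     | `[< exists a : Sigma, evals pi s qr.1 a qr.2 true >] ].

(* Meaningful when [pi] is well-defined: [pick] then returns the unique letter
   output at a pair of J, and in particular [pmap] discards nothing. *)
Definition transduction (Sigma Gamma : finType) (m : nat)
    (pi : interpretation Sigma Gamma m) (s : seq Gamma) : seq Sigma :=
  pmap (fun qr => [pick a : Sigma | `[< evals pi s qr.1 a qr.2 true >] ])
    (live pi s).

(* A transition (q, a, v, q') goes from q to q', writes the word v, and reads
   the letter c if a = Some c and nothing if a = None. *)
Record transducer (Gamma Sigma : finType) := Transducer {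
  state : finType;
  initial : {set state};
  final : {set state};
  transitions : seq (state * option Gamma * seq Sigma * state)
}.

Inductive run (Gamma Sigma : finType) (A : transducer Gamma Sigma) :
    state A -> seq Gamma -> seq Sigma -> state A -> Prop :=
| run_nil q : run q [::] [::] q
| run_letter q c v q' s t r :
    (q, Some c, v, q') \in transitions A -> run q' s t r ->
    run q (c :: s) (v ++ t) r
| run_eps q v q' s t r :
    (q, None, v, q') \in transitions A -> run q' s t r ->
    run q s (v ++ t) r.

Definition realizes (Gamma Sigma : finType) (A : transducer Gamma Sigma)
    (s : seq Gamma) (t : seq Sigma) : Prop :=
  exists q r, [/\ q \in initial A, r \in final A & run q s t r].

(* Partial functions are option-valued. *)
Definition rational (Gamma Sigma : finType)
    (f : seq Gamma -> option (seq Sigma)) : Prop :=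
  exists A : transducer Gamma Sigma,
    forall s t, realizes A s t <-> f s = Some t.

(* Main.v *)
(* From interpretations to transducers.  A transducer guesses, for every index
   of the input, a table that sends each recursive name to an optional boolean,
   and checks that the tables are closed under the defining equations.  Such
   tables contain the least fixed point, and since every head is decided by the
   least fixed point of a well-defined interpretation, all of them yield the
   same values for the heads: minimality of the guess need not be verified.
   Terms look only a bounded distance away, so that a sliding window suffices.

   From transducers to interpretations.  Reading a single letter, between
   arbitrary epsilon transitions, is a relation between states; a word is chosen
   for each of its instances.  The set of states from which the remaining suffix
   is accepted is computed by recursion through the successor, and an accepting
   run is then selected by recursion through the predecessor. *)
Require Import Defs.
From mathcomp Require Import all_boot finmap.
From mathcomp Require Import boolp.
From mathcomp Require Import zify.

Set Implicit Arguments.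
Unset Strict Implicit.
Unset Printing Implicit Defensive.

(* Determinism of evaluation and reach of terms *)
Scheme ieval_mind := Minimality for ieval Sort Prop
  with beval_mind := Minimality for beval Sort Prop.
Combined Scheme eval_mutind from ieval_mind, beval_mind.

Scheme iterm_mind := Induction for iterm Sort Prop
  with bterm_mind := Induction for bterm Sort Prop.
Combined Scheme term_mutind from iterm_mind, bterm_mind.

(** Induction on the first derivation; two derivations for a conditional that took different
    branches would give its guard two values. *)
Lemma eval_functional (Gamma : eqType) (p : headless Gamma) (s : seq Gamma) :
  (forall x T v, ieval p s x T v -> forall v', ieval p s x T v' -> v = v') /\
  (forall x T b, beval p s x T b -> forall b', beval p s x T b' -> b = b').
Proof.
apply: eval_mutind => //=.
- by move=> x v' H; inversion H.
- by move=> x T v _ IH v' H; inversion H as [|? ? u Hu| | |]; rewrite (IH u).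
- by move=> x T v _ IH v' H; inversion H as [| |? ? u Hu| |]; rewrite (IH u).
- move=> x T0 T1 T2 v _ IH0 _ IH1 v' H; inversion H as [| | | |]; subst.
    exact: IH1.
  by suff: true = false by []; apply: IH0.
- move=> x T0 T1 T2 v _ IH0 _ IH1 v' H; inversion H as [| | | |]; subst.
    by suff: false = true by []; apply: IH0.
  exact: IH1.
- by move=> x b' H; inversion H.
- by move=> x b' H; inversion H.
- by move=> x T v _ IH b' H; inversion H as [| |? ? u Hu| | | | |]; rewrite (IH u).
- by move=> x T v _ IH b' H; inversion H as [| | |? ? u Hu| | | |]; rewrite (IH u).
- move=> x a T v _ IH b' H; inversion H as [| | | |? ? ? u Hu| | |].
  by rewrite (IH u).
- move=> x f Tf T v w Df _ IH _ IHf b' H.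
  inversion H as [| | | | |? ? Tf' ? u ? Df' Hu Hw| |]; subst.
  by apply: IHf; rewrite (IH u) //; move: Df'; rewrite Df => -[->].
- move=> x T0 T1 T2 v _ IH0 _ IH1 v' H; inversion H as [| | | | | | |]; subst.
    exact: IH1.
  by suff: true = false by []; apply: IH0.
- move=> x T0 T1 T2 v _ IH0 _ IH1 v' H; inversion H as [| | | | | | |]; subst.
    by suff: false = true by []; apply: IH0.
  exact: IH1.
Qed.

Lemma beval_functional (Gamma : eqType) (p : headless Gamma) (s : seq Gamma)
    x T b b' :
  beval p s x T b -> beval p s x T b' -> b = b'.
Proof. by move=> H H'; exact: (proj2 (eval_functional p s) _ _ _ H). Qed.

(** Bounds how far evaluation may look when calls are answered by a table: a call costs only its
    argument, while [BMax] and [BMin] also inspect a neighbour. *)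
Fixpoint ireach (Gamma : Type) (T : iterm Gamma) : nat :=
  match T with
  | IVar => 0
  | ISucc T1 | IPred T1 => (ireach T1).+1
  | IIf T0 T1 T2 => breach T0 + ireach T1 + ireach T2
  end
with breach (Gamma : Type) (T : bterm Gamma) : nat :=
  match T with
  | BTrue | BFalse => 0
  | BCall _ T1 | BChar _ T1 => ireach T1
  | BMax T1 | BMin T1 => (ireach T1).+1
  | BIf T0 T1 T2 => breach T0 + breach T1 + breach T2
  end.

(** * Evaluation relative to guessed tables *)

Section Oracle.
Variables (Gamma : finType) (p : headless Gamma).

Definition table := {ffun domf (defs p) -> option bool}.
Definition cell := (Gamma * table)%type.

Definition lookup (A : table) (f : nat) : option bool :=
  if insub f is Some k then A k else None.

Definition ostep (V : nat -> option cell) (w v : nat) : nat :=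
  if V w then w else v.

(* [V] is a tabulated input string padded with [None]: the two ends of the string
   are recognised by a neighbour that is [None], which makes evaluation local. *)
Fixpoint oieval (V : nat -> option cell) (x : nat) (T : iterm Gamma) :
    option nat :=
  match T with
  | IVar => Some x
  | ISucc T1 => omap (fun v => ostep V v.+1 v) (oieval V x T1)
  | IPred T1 => omap (fun v => ostep V v.-1 v) (oieval V x T1)
  | IIf T0 T1 T2 =>
      obind (fun b : bool => if b then oieval V x T1 else oieval V x T2)
        (obeval V x T0)
  end
with obeval (V : nat -> option cell) (x : nat) (T : bterm Gamma) :
    option bool :=
  match T with
  | BTrue => Some true
  | BFalse => Some false
  | BCall f T1 =>
      obind (fun v => obind (fun cA => lookup cA.2 f) (V v)) (oieval V x T1)
  | BChar a T1 => omap (fun v => omap fst (V v) == Some a) (oieval V x T1)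
  | BMax T1 => omap (fun v => ~~ V v.+1) (oieval V x T1)
  | BMin T1 => omap (fun v => ~~ V v.-1) (oieval V x T1)
  | BIf T0 T1 T2 =>
      obind (fun b : bool => if b then obeval V x T1 else obeval V x T2)
        (obeval V x T0)
  end.

Lemma oieval_range V x T v :
  oieval V x T = Some v -> x - ireach T <= v <= x + ireach T.
Proof.
elim: T v => [|T IH|T IH|T0 T1 IH1 T2 IH2] v /=.
- by move=> [<-]; lia.
- case E: (oieval V x T) => [u|] //= [<-]; have := IH _ E.
  by rewrite /ostep; case: ifP => _; lia.
- case E: (oieval V x T) => [u|] //= [<-]; have := IH _ E.
  by rewrite /ostep; case: ifP => _; lia.
- by case: (obeval V x T0) => [[]|] //= /[dup] E; [move/IH1|move/IH2]; lia.
Qed.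

(** A term sees only cells within its reach, so equal cells give equal values after a shift. The
    lower bound on [k] keeps evaluation in [W] away from the truncation of the predecessor at 0. *)
Lemma oeval_local (V W : nat -> option cell) (a k L : nat) :
  (forall j, j < L -> V (a + j) = W j) ->
  (forall T, ireach T <= k -> k + ireach T < L ->
     oieval V (a + k) T = omap (addn a) (oieval W k T)) /\
  (forall T, breach T <= k -> k + breach T < L ->
     obeval V (a + k) T = obeval W k T).
Proof.
move=> VW.
(* The index reached lies in the common part, and so does its neighbour on either side whenever the
   reach leaves room for one more step. *)
have range T v : oieval W k T = Some v -> ireach T <= k -> k + ireach T < L ->
    (v < L) /\ (ireach T < k -> 0 < v) /\ ((k + ireach T).+1 < L -> v.+1 < L).
  by move/oieval_range; lia.
apply: term_mutind => //=.
- move=> T IH lo hi; rewrite IH; [|lia|lia].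
  case E: (oieval W k T) => [v|] //=.
  have [||_ [_ lt]] := range T v E; [lia|lia|].
  by rewrite /ostep -addnS VW; [case: (W v.+1)|apply: lt; lia].
- move=> T IH lo hi; rewrite IH; [|lia|lia].
  case E: (oieval W k T) => [v|] //=.
  have [||lt [/(_ lo) v0 _]] := range T v E; [lia|lia|].
  have -> : (a + v).-1 = a + v.-1 by lia.
  rewrite /ostep VW; last lia.
  by case: (W v.-1).
- move=> T0 IH0 T1 IH1 T2 IH2 lo hi; rewrite IH0; [|lia|lia].
  by case: (obeval W k T0) => [[]|] //=; [apply: IH1; lia|apply: IH2; lia].
- move=> f T IH lo hi; rewrite IH //.
  case E: (oieval W k T) => [v|] //=.
  by have [||lt _] := range T v E => //; rewrite VW.
- move=> c T IH lo hi; rewrite IH //.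
  case E: (oieval W k T) => [v|] //=.
  by have [||lt _] := range T v E => //; rewrite VW.
- move=> T IH lo hi; rewrite IH; [|lia|lia].
  case E: (oieval W k T) => [v|] //=.
  have [||_ [_ lt]] := range T v E; [lia|lia|].
  by rewrite -addnS VW //; apply: lt; lia.
- move=> T IH lo hi; rewrite IH; [|lia|lia].
  case E: (oieval W k T) => [v|] //=.
  have [||lt [/(_ lo) v0 _]] := range T v E; [lia|lia|].
  have -> : (a + v).-1 = a + v.-1 by lia.
  rewrite VW //; lia.
- move=> T0 IH0 T1 IH1 T2 IH2 lo hi; rewrite IH0; [|lia|lia].
  by case: (obeval W k T0) => [[]|] //=; [apply: IH1; lia|apply: IH2; lia].
Qed.

(** Only an inclusion is checked: the table must record every value of a defining term, and may
    record more. *)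
Definition closed_at (V : nat -> option cell) (x : nat) : bool :=
  if V x is Some cA then
    [forall k : domf (defs p), forall b,
       (obeval V x (defs p k) == Some b) ==> (cA.2 k == Some b)]
  else false.

(** The right padding comes from [onth], which is [None] beyond the end of [s]. The tables are left
    free. *)
Definition represents (d : nat) (V : nat -> option cell) (s : seq Gamma) :=
  (forall j, j < d -> V j = None) /\
  (forall i, omap fst (V (d + i)) = onth s i).

(** * Closed tables contain every derivable value *)

Section Represents.
Variables (d : nat) (V : nat -> option cell) (s : seq Gamma).
Hypothesis Vs : represents d V s.

Lemma represents_isSome i : V (d + i) = (i < size s) :> bool.
Proof.
by rewrite -onthTE -(proj2 Vs); case: (V (d + i)).
Qed.

Lemma ostep_succ v : v < size s ->
  ostep V (d + v).+1 (d + v) = d + minn v.+1 (size s).-1.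
Proof.
move=> vs; rewrite /ostep -addnS represents_isSome.
by case: ltnP => ?; lia.
Qed.

Lemma represents_max v : v < size s ->
  ~~ V (d + v).+1 = (v == (size s).-1).
Proof. by move=> vs; rewrite -addnS represents_isSome; lia. Qed.

(** Since [0.-1 = 0], a string placed at 0 would have no padding to its left, and [BMin] would not
    detect its first index. *)
Hypothesis d_gt0 : 0 < d.

Lemma represents_pred v : v < size s -> V (d + v).-1 = (v != 0) :> bool.
Proof.
move=> vs; case: v vs => [|v] vs.
  by rewrite addn0 (proj1 Vs) //; lia.
by rewrite addnS /= represents_isSome; lia.
Qed.

Lemma ostep_pred v : v < size s -> ostep V (d + v).-1 (d + v) = d + v.-1.
Proof. by move=> vs; rewrite /ostep represents_pred //; case: v vs => [|v] _ //=; lia. Qed.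

Lemma represents_min v : v < size s -> ~~ V (d + v).-1 = (v == 0).
Proof. by move=> vs; rewrite represents_pred // negbK. Qed.

Hypothesis closedV : forall x, x < size s -> closed_at V (d + x).

Lemma closed_lookup v f Tf w : v < size s -> (defs p).[? f]%fmap = Some Tf ->
  obeval V (d + v) Tf = Some w ->
  obind (fun cA => lookup cA.2 f) (V (d + v)) = Some w.
Proof.
move=> vs Df ob; have := closedV vs; rewrite /closed_at.
case E: (V (d + v)) => [cA|] //= /forallP H.
have fD : f \in domf (defs p) by rewrite -fndSome Df.
rewrite /lookup (insubT (fun f => f \in domf (defs p)) fD).
have := H [` fD]%fset => /forallP/(_ w).
have -> : defs p [` fD]%fset = Tf by move: Df; rewrite in_fnd => -[].
by rewrite ob eqxx /= => /eqP.
Qed.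

(** Induction on derivations: once the body of a called definition evaluates to [w], closedness
    forces the table to answer [w]. *)
Lemma oeval_complete :
  (forall x T v, ieval p s x T v -> x < size s ->
     v < size s /\ oieval V (d + x) T = Some (d + v)) /\
  (forall x T b, beval p s x T b -> x < size s ->
     obeval V (d + x) T = Some b).
Proof.
apply: eval_mutind => //=.
- move=> x T v _ IH xs; have [vs ->] := IH xs; split; first by lia.
  by rewrite /= ostep_succ.
- move=> x T v _ IH xs; have [vs ->] := IH xs; split; first by lia.
  by rewrite /= ostep_pred.
- by move=> x T0 T1 T2 v _ IH0 _ IH1 xs; rewrite IH0 //=; apply: IH1.
- by move=> x T0 T1 T2 v _ IH0 _ IH1 xs; rewrite IH0 //=; apply: IH1.
- by move=> x T v _ IH xs; have [vs ->] := IH xs; rewrite /= represents_min.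
- by move=> x T v _ IH xs; have [vs ->] := IH xs; rewrite /= represents_max.
- by move=> x a T v _ IH xs; have [vs ->] := IH xs; rewrite /= (proj2 Vs).
- move=> x f Tf T v w Df _ IH _ IHf xs; have [vs ->] := IH xs => /=.
  by apply: (closed_lookup vs Df); apply: IHf.
- by move=> x T0 T1 T2 v _ IH0 _ IH1 xs; rewrite IH0 //=; apply: IH1.
- by move=> x T0 T1 T2 v _ IH0 _ IH1 xs; rewrite IH0 //=; apply: IH1.
Qed.

End Represents.

(** * The table of derivable values is closed *)

Section LeastTable.
Variable s : seq Gamma.

(* By functionality of [beval] the order of the two tests is immaterial. *)
Definition least_table (x : nat) : table :=
  [ffun k => if `[< beval p s x (defs p k) true >] then Some true
             else if `[< beval p s x (defs p k) false >] then Some false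
             else None].

Definition least_view (d j : nat) : option cell :=
  if j < d then None
  else omap (fun c => (c, least_table (j - d))) (onth s (j - d)).

Lemma least_viewD d i :
  least_view d (d + i) = omap (fun c => (c, least_table i)) (onth s i).
Proof. by rewrite /least_view ltnNge leq_addr /= addKn. Qed.

Lemma least_view_represents d : represents d (least_view d) s.
Proof.
split=> [j jd|i]; first by rewrite /least_view jd.
by rewrite least_viewD; case: (onth s i).
Qed.

Variable d : nat.
Hypothesis d_gt0 : 0 < d.
Let V := least_view d.
Let Vs := least_view_represents d.

(** Every entry of this table comes with a derivation, so calls need not be unfolded and structural
    induction on terms suffices. *)
Lemma oeval_least :
  (forall T x w, x < size s -> oieval V (d + x) T = Some w ->
     exists v, [/\ w = d + v, v < size s & ieval p s x T v]) /\
  (forall T x b, x < size s -> obeval V (d + x) T = Some b -> beval p s x T b).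
Proof.
apply: term_mutind => /=.
- by move=> x w xs [<-]; exists x; split=> //; constructor.
- move=> T IH x w xs; case E: (oieval V _ T) => [u|] //= [<-].
  have [v [-> vs Hv]] := IH _ _ xs E.
  exists (minn v.+1 (size s).-1); rewrite (ostep_succ Vs) //; split=> //; first lia.
  by constructor.
- move=> T IH x w xs; case E: (oieval V _ T) => [u|] //= [<-].
  have [v [-> vs Hv]] := IH _ _ xs E.
  exists v.-1; rewrite (ostep_pred Vs d_gt0) //; split=> //; first lia.
  by constructor.
- move=> T0 IH0 T1 IH1 T2 IH2 x w xs.
  case E: (obeval V _ T0) => [[]|] //= E'.
    have [v [-> vs Hv]] := IH1 _ _ xs E'; exists v; split=> //.
    by apply: ieval_if_true => //; apply: IH0.
  have [v [-> vs Hv]] := IH2 _ _ xs E'; exists v; split=> //.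
  by apply: ieval_if_false => //; apply: IH0.
- by move=> x b _ [<-]; constructor.
- by move=> x b _ [<-]; constructor.
- move=> f T IH x b xs; case E: (oieval V _ T) => [u|] //=.
  have [v [-> vs Hv]] := IH _ _ xs E.
  rewrite /V least_viewD; case: (onth s v) => [c|] //=.
  rewrite /lookup; case: insubP => [k kD kf|] //; rewrite ffunE => H.
  have Df : (defs p).[? f]%fmap = Some (defs p k) by rewrite -kf Some_fnd.
  apply: (beval_call Df Hv); move: H.
  by case: asboolP => [H [<-] //|_]; case: asboolP => // H [<-].
- move=> a T IH x b xs; case E: (oieval V _ T) => [u|] //= [<-].
  have [v [-> vs Hv]] := IH _ _ xs E.
  by rewrite (proj2 Vs); constructor.
- move=> T IH x b xs; case E: (oieval V _ T) => [u|] //= [<-].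
  have [v [-> vs Hv]] := IH _ _ xs E.
  by rewrite (represents_max Vs) //; constructor.
- move=> T IH x b xs; case E: (oieval V _ T) => [u|] //= [<-].
  have [v [-> vs Hv]] := IH _ _ xs E.
  by rewrite (represents_min Vs d_gt0) //; constructor.
- move=> T0 IH0 T1 IH1 T2 IH2 x b xs.
  case E: (obeval V _ T0) => [[]|] //= E'.
    by apply: beval_if_true; [apply: IH0|apply: IH1].
  by apply: beval_if_false; [apply: IH0|apply: IH2].
Qed.

Lemma least_view_closed x : x < size s -> closed_at V (d + x).
Proof.
move=> xs; rewrite /closed_at /V least_viewD -/V.
case E: (onth s x) => [c|] /=; last by have := onthTE s x; rewrite E xs.
apply/forallP => k; apply/forallP => b; apply/implyP => /eqP ob.
have Hb := proj2 oeval_least _ _ _ xs ob.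
rewrite ffunE; case: b Hb {ob} => Hb; first by rewrite asboolT.
(* For the value false, determinism refutes the test for true, which the table makes first. *)
rewrite asboolF ?asboolT // => Ht.
by have := beval_functional Hb Ht.
Qed.

End LeastTable.
End Oracle.

(** * The sliding-window transducer of an interpretation *)

Lemma pmap_flatten (T1 T2 : Type) (f : T1 -> option T2) (ss : seq (seq T1)) :
  pmap f (flatten ss) = flatten (map (pmap f) ss).
Proof. by elim: ss => //= s ss IH; rewrite pmap_cat IH. Qed.

(** Outside J the [pick] fails and [pmap] drops the pair, so the filter can be removed and the
    output splits into one block per input index. *)
Lemma transductionE (Sigma Gamma : finType) (m : nat)
    (pi : interpretation Sigma Gamma m) (s : seq Gamma) :
  transduction pi s =
  flatten [seq pmap (fun i => [pick a | `[< evals pi s q a i true >]])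
             (enum 'I_m) | q <- iota 0 (size s)].
Proof.
rewrite /transduction /live.
set F := fun qr : nat * 'I_m => _; set P := fun qr : nat * 'I_m => _.
have filterP l : pmap F [seq qr <- l | P qr] = pmap F l.
  elim: l => //= qr l IH; rewrite /P; case: asboolP => [_|nP] /=; rewrite IH //.
  suff -> : F qr = None by [].
  rewrite /F; case: pickP => // a /asboolP ea.
  by case: nP; exists a.
rewrite filterP /allpairs pmap_flatten -map_comp; congr flatten; apply: eq_map => q /=.
by elim: (enum _) => //= i l ->.
Qed.

Section WindowTransducer.
Variables (Sigma Gamma : finType) (m : nat).
Variable pi : interpretation Sigma Gamma m.

Let p := body pi.

Implicit Types V : nat -> option (cell p).

(** Exceeds the reach of all definitions and heads; the successor also provides the padding cell
    needed on the left. *)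
Definition radius : nat :=
  (\max_(k : domf (defs p)) breach (defs p k) +
   \max_(ai : Sigma * 'I_m) breach (Defs.head pi ai.1 ai.2)).+1.
Notation d := radius.

Lemma breach_defs (k : domf (defs p)) : breach (defs p k) < d.
Proof.
have := @leq_bigmax _ (fun k : domf (defs p) => breach (defs p k)) k.
by rewrite /radius /=; lia.
Qed.

Lemma breach_head a i : breach (Defs.head pi a i) < d.
Proof.
have := @leq_bigmax _ (fun ai => breach (Defs.head pi ai.1 ai.2)) (a, i).
by rewrite /radius /=; lia.
Qed.

Definition output V (x : nat) : seq Sigma :=
  pmap (fun i => [pick a : Sigma | obeval V x (Defs.head pi a i) == Some true])
    (enum 'I_m).

Lemma obeval_window V (W : nat -> option (cell p)) a k T :
  d <= k -> (forall j, j <= k + d -> V (a + j) = W j) -> breach T < d ->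
  obeval V (a + k) T = obeval W k T.
Proof.
move=> dk VW Td.
have VW' j : j < (k + d).+1 -> V (a + j) = W j := VW j.
by apply: (proj2 (oeval_local k VW')); lia.
Qed.

Lemma closed_window V (W : nat -> option (cell p)) a k :
  d <= k -> (forall j, j <= k + d -> V (a + j) = W j) ->
  closed_at V (a + k) = closed_at W k.
Proof.
move=> dk VW; rewrite /closed_at VW ?leq_addr //; case: (W k) => // cA.
apply: eq_forallb => f; apply: eq_forallb => b.
by rewrite (obeval_window dk VW) // breach_defs.
Qed.

Lemma output_window V (W : nat -> option (cell p)) a k :
  d <= k -> (forall j, j <= k + d -> V (a + j) = W j) ->
  output V (a + k) = output W k.
Proof.
move=> dk VW; apply: eq_pmap => i; apply: eq_pick => c.
by rewrite /= (obeval_window dk VW) // breach_head.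
Qed.

(** The centre, at offset [d], is the index being read; it has [d] neighbours on each side. *)
Definition window := (d + d).+1.-tuple (option (cell p)).

Definition window_at V : window :=
  [tuple V j | j < (d + d).+1].

Lemma nth_window_at V j : j <= d + d -> nth None (window_at V) j = V j.
Proof. by move=> jd; rewrite -[j]/(val (Ordinal (jd : j < (d + d).+1))) -tnth_nth tnth_mktuple. Qed.

(** The last cell of the new window is unconstrained: this is where the transducer guesses. *)
Definition slides (e : window * Gamma * window) : bool :=
  [&& omap fst (nth None e.1.1 d) == Some e.1.2,
      closed_at (nth None e.1.1) d &
      [forall j : 'I_(d + d), nth None e.1.1 j.+1 == nth None e.2 j]].

Definition transition_of (e : window * Gamma * window) :
    window * option Gamma * seq Sigma * window :=
  (e.1.1, Some e.1.2, output (nth None e.1.1) d, e.2).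

(** Padding left of the centre marks the start of the input; padding from the centre on marks its
    end. *)
Definition window_transducer : transducer Gamma Sigma := {|
  state := window;
  initial := [set W : window | [forall j : 'I_d, nth None W j == None]];
  final := [set W : window | [forall j : 'I_d.+1, nth None W (d + j) == None]];
  transitions :=
    [seq transition_of e | e <- enum {: window * Gamma * window} & slides e] |}.

Lemma window_transitionP (W : window) (o : option Gamma) t (W' : window) :
  reflect (exists c, [/\ o = Some c, t = output (nth None W) d &
                         slides (W, c, W')])
    ((W, o, t, W') \in transitions window_transducer).
Proof.
apply: (iffP mapP) => [[[[W1 c] W2]]|[c [-> -> H]]].
  by rewrite mem_filter => /andP[H _] [-> -> -> ->]; exists c.
by exists (W, c, W') => //; rewrite mem_filter H mem_enum.
Qed.

(** * Runs of the transducer as tabulated strings *)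

Definition outputs V (n : nat) : seq Sigma :=
  flatten [seq output V (d + i) | i <- iota 0 n].

Lemma outputsS V n :
  outputs V n.+1 = output V d ++ outputs (V \o succn) n.
Proof.
rewrite /outputs /= addn0 -[1]addn0 iotaDl -map_comp; congr (_ ++ flatten _).
apply: eq_map => i /=; rewrite addnCA.
by apply: output_window => [|j _ //]; apply: leq_addr.
Qed.

Lemma closed_succ V i : closed_at V (d + i.+1) = closed_at (V \o succn) (d + i).
Proof.
rewrite addnS -add1n.
by apply: closed_window => [|j _ //]; apply: leq_addr.
Qed.

(** Consecutive windows overlap in all but one cell, so those of an accepting run glue together into
    a single view. *)
Lemma run_window W s t W' :
  @run _ _ window_transducer W s t W' -> W' \in final window_transducer ->
  exists V, [/\ forall j, j <= d + d -> V j = nth None W j,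
    forall i, omap fst (V (d + i)) = onth s i,
    forall i, i < size s -> closed_at V (d + i) & t = outputs V (size s)].
Proof.
elim=> {W s t W'} [W|W c v W1 s t W2 e _ IH|W v W1 s t W2 e _ _]; last first.
- by case/window_transitionP: e => c [].
- move=> /IH[V [VW Vs closedV ->]].
  case/window_transitionP: e => _ [[<-] -> /and3P[/= /eqP Wd closedW /forallP slide]].
  (* Each letter read prepends the leftmost cell of its window to the view of the rest. *)
  pose V1 j := if j is j'.+1 then V j' else nth None W 0.
  have VW1 j : j <= d + d -> V1 (0 + j) = nth None W j.
    case: j => // j jd; rewrite /V1 add0n VW; last lia.
    by have /eqP<- := slide (Ordinal jd).
  exists V1; split=> //.
  + case=> [|i]; last by rewrite addnS; exact: Vs.
    by rewrite addn0 -[d]add0n VW1 ?leq_addr.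
  + case=> [|i] i_s; last by rewrite closed_succ; exact: closedV.
    by rewrite addn0 -[X in closed_at _ X]add0n (@closed_window _ (nth None W)).
  + rewrite /= outputsS; congr (_ ++ _).
    by rewrite -[X in output V1 X]add0n; apply/esym/output_window.
rewrite inE => /forallP Wfin.
(* At the end of the input, the default [None] extends the final window by padding. *)
exists (nth None W); split=> // i; rewrite onth0n.
case: (leqP i d) => id; last by rewrite nth_default // size_tuple; lia.
by have /eqP-> := Wfin (Ordinal (id : i < d.+1)).
Qed.

Lemma window_run V s :
  (forall i, i < size s -> omap fst (V (d + i)) = onth s i) ->
  (forall i, i < size s -> closed_at V (d + i)) ->
  @run _ _ window_transducer (window_at V) s (outputs V (size s))
    (window_at (fun j => V (size s + j))).
Proof.
elim: s V => [|c s IH] V Vs closedV /=; first exact: run_nil.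
have VW j : j <= d + d -> V (0 + j) = nth None (window_at V) j.
  by move=> jd; rewrite nth_window_at.
rewrite outputsS; apply: (@run_letter _ _ window_transducer _ _ _
  (window_at (V \o succn))); last first.
  have := IH (V \o succn); apply=> i i_s /=.
    by rewrite -addnS Vs.
  by rewrite -closed_succ closedV.
apply/window_transitionP; exists c; split=> //.
  by rewrite -[X in output _ X]add0n; apply: output_window.
apply/and3P; split=> /=.
- by rewrite nth_window_at ?leq_addr // -[X in V X]addn0 Vs.
- rewrite -(@closed_window V _ 0) // add0n -[X in closed_at _ X]addn0.
  exact: closedV.
- apply/forallP => j; rewrite nth_window_at //; apply/eqP/esym.
  exact: (nth_window_at (V \o succn) (ltnW (ltn_ord j))).
Qed.

Hypothesis pi_wd : well_defined pi.

(** Well-definedness gives each head a derivable value, and closed tables reproduce it; surplus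
    entries therefore cannot affect the output. *)
Lemma outputs_transduction V s :
  represents d V s -> (forall x, x < size s -> closed_at V (d + x)) ->
  outputs V (size s) = transduction pi s.
Proof.
move=> Vs closedV.
have headE x a i : x < size s ->
    (obeval V (d + x) (Defs.head pi a i) == Some true) = `[< evals pi s x a i true >].
  move=> xs; have [_ compl] := oeval_complete Vs isT closedV.
  case: asboolP => [/compl-> //|not_true].
  by have [_ /(_ a not_true)/compl->] := pi_wd i xs.
rewrite transductionE; congr flatten; apply/eq_in_map => x.
rewrite mem_iota => xs; apply: eq_pmap => i; apply: eq_pick => a.
exact: headE.
Qed.

Lemma transduction_rational : rational (fun s => Some (transduction pi s)).
Proof.
exists window_transducer => s t; split.
  case=> W [W' [Wini Wfin /run_window/(_ Wfin)[V [VW Vs closedV ->]]]].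
  congr Some; apply/esym/outputs_transduction => //; split=> // j jd.
  rewrite VW; last lia.
  by move: Wini; rewrite inE => /forallP/(_ (Ordinal jd))/eqP.
(* An accepting run exists because the least tables are a valid guess. *)
case=> <-; pose V := @least_view _ p s d.
have Vs : represents d V s by apply: least_view_represents.
have closedV x : x < size s -> closed_at V (d + x) by exact: least_view_closed.
exists (window_at V), (window_at (fun j => V (size s + j))); split.
- rewrite inE; apply/forallP => j; rewrite nth_window_at ?(proj1 Vs) //.
  by have := ltn_ord j; lia.
- rewrite inE; apply/forallP => j; rewrite nth_window_at; last first.
    by have := ltn_ord j; lia.
  have := proj2 Vs (size s + j); rewrite onth_default ?leq_addr // addnCA.
  by case: (V _).
- rewrite -(outputs_transduction Vs closedV); apply: window_run => // i _.
  exact: (proj2 Vs).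
Qed.

End WindowTransducer.

(** * Bimachines as interpretations *)

Section Bimachine.
Variables (Sigma Gamma R Q : finType).
(** [R] is the automaton reading from right to left; [Q] reads from left to right and sees the right
    state of the remaining suffix, already when it starts. *)
Variables (r0 : R) (stepR : Gamma -> R -> R).
Variables (startQ : R -> Q) (stepQ : Q -> Gamma -> R -> Q).
Variable word : Q -> Gamma -> R -> seq Sigma.

Definition rstate (u : seq Gamma) : R := foldr stepR r0 u.

Fixpoint lstate (q : Q) (s : seq Gamma) (x : nat) : Q :=
  match s, x with
  | c :: u, x'.+1 => lstate (stepQ q c (rstate u)) u x'
  | _, _ => q
  end.

Fixpoint bioutput (q : Q) (s : seq Gamma) : seq Sigma :=
  if s is c :: u then word q c (rstate u) ++ bioutput (stepQ q c (rstate u)) u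
  else [::].

(** Unfolds the left state at its last step, to match recursion through the predecessor. *)
Lemma lstateS q s x c : onth s x = Some c ->
  lstate q s x.+1 = stepQ (lstate q s x) c (rstate (drop x.+1 s)).
Proof.
elim: s x q => [|c' u IH] [|x] q //=; last by move/IH->.
by move=> [->]; rewrite drop0; case: u {IH}.
Qed.

Definition word_at (q : Q) (s : seq Gamma) (x : nat) : seq Sigma :=
  if onth s x is Some c then word (lstate q s x) c (rstate (drop x.+1 s))
  else [::].

Lemma bioutputE q s :
  bioutput q s = flatten [seq word_at q s x | x <- iota 0 (size s)].
Proof.
elim: s q => //= c u IH q; rewrite {1}/word_at /= drop0; congr (_ ++ _).
by rewrite IH -[1]addn0 iotaDl -map_comp.
Qed.

(** * States of both automata as recursive functions *)

Definition bconst (b : bool) : bterm Gamma := if b then BTrue else BFalse.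
Definition band (t u : bterm Gamma) : bterm Gamma := BIf t u BFalse.
Definition bany (l : seq (bterm Gamma)) : bterm Gamma :=
  foldr (fun t acc => BIf t BTrue acc) BFalse l.

Definition callR (r : R) (T : iterm Gamma) : bterm Gamma :=
  BCall (choice.pickle (inl r : R + Q)) T.
Definition callQ (q : Q) (T : iterm Gamma) : bterm Gamma :=
  BCall (choice.pickle (inr q : R + Q)) T.

(* True at [x] iff [r] is the right state on the suffix that starts at [x + 1];
   at the last index, where the successor is not available, it is [r0]. *)
Definition nextR (r : R) : bterm Gamma :=
  BIf (BMax IVar) (bconst (r0 == r)) (callR r (ISucc IVar)).

Definition defR (r : R) : bterm Gamma :=
  bany [seq band (BChar y.1 IVar) (nextR y.2)
         | y <- enum {: Gamma * R} & stepR y.1 y.2 == r].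

(** The step into [x] reads the letter at the predecessor; the suffix after that letter starts at
    [x], hence [callR] is applied to [IVar]. *)
Definition defQ (q : Q) : bterm Gamma :=
  BIf (BMin IVar)
    (bany [seq callR r IVar | r <- enum R & startQ r == q])
    (bany [seq band (callQ y.1.1 (IPred IVar))
                 (band (BChar y.1.2 (IPred IVar)) (callR y.2 IVar))
            | y <- enum {: Q * Gamma * R} & stepQ y.1.1 y.1.2 y.2 == q]).

Definition head_term (a : Sigma) (i : nat) : bterm Gamma :=
  bany [seq band (callQ y.1.1 IVar) (band (BChar y.1.2 IVar) (nextR y.2))
         | y <- enum {: Q * Gamma * R} &
             onth (word y.1.1 y.1.2 y.2) i == Some a].

Definition def_of (k : R + Q) : bterm Gamma :=
  match k with inl r => defR r | inr q => defQ q end.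

Definition names : {fset nat} := [fset choice.pickle k | k in {: R + Q}]%fset.

Lemma mem_names (k : R + Q) : choice.pickle k \in names.
Proof. by apply/imfsetP; exists k. Qed.

Definition state_defs : {fmap nat -> bterm Gamma} :=
  [fmap f : names => if choice.unpickle (val f) is Some k then def_of k else BFalse]%fmap.

Lemma state_defsE k : (state_defs.[? choice.pickle k])%fmap = Some (def_of k).
Proof. by rewrite (in_fnd (mem_names k)) ffunE /= choice.pickleK. Qed.

Lemma all_names_bany (T : Type) (l : seq T) (F : T -> bterm Gamma) (P : pred T) :
  (forall y, all [in names] (bnames (F y))) ->
  all [in names] (bnames (bany [seq F y | y <- l & P y])).
Proof.
move=> namesF; elim: l => //= y l IH; case: (P y) => //=.
by rewrite all_cat namesF.
Qed.

Lemma all_names_nextR r : all [in names] (bnames (nextR r)).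
Proof. by rewrite /nextR; case: (r0 == r) => /=; rewrite mem_names. Qed.

Lemma all_names_def k : all [in names] (bnames (def_of k)).
Proof.
case: k => [r|q] /=.
  by apply: all_names_bany => y /=; rewrite cats0 all_names_nextR.
rewrite all_cat; apply/andP; split; apply: all_names_bany => y /=.
  by rewrite mem_names.
by rewrite !mem_names.
Qed.

Lemma all_names_head a i : all [in names] (bnames (head_term a i)).
Proof.
apply: all_names_bany => y /=.
by rewrite mem_names /= !cats0 all_names_nextR.
Qed.

Lemma names_neq0 : domf state_defs != fset0.
Proof.
by apply/fset0Pn; exists (choice.pickle (inl r0 : R + Q)); apply: mem_names.
Qed.

Lemma state_defs_closed f T :
  (state_defs.[? f])%fmap = Some T -> {subset bnames T <= domf state_defs}.
Proof.
case: fndP => // fD [<-]; rewrite ffunE /=.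
by case: choice.unpickle => [k|] //; apply/allP/all_names_def.
Qed.

Definition state_scheme : headless Gamma :=
  Headless names_neq0 state_defs_closed.

Notation p := state_scheme.

(** * Evaluation of the state functions and heads *)

Section Evaluation.
Variable s : seq Gamma.

Lemma beval_call_def k x T v b : ieval p s x T v -> beval p s v (def_of k) b ->
  beval p s x (BCall (choice.pickle k) T) b.
Proof. by move=> Tv; apply: beval_call Tv; apply: state_defsE. Qed.

Lemma beval_const x b : beval p s x (bconst b) b.
Proof. by case: b; constructor. Qed.

Lemma beval_band x t u b b' :
  beval p s x t b -> beval p s x u b' -> beval p s x (band t u) (b && b').
Proof.
case: b => Ht Hu; first exact: beval_if_true.
by apply: beval_if_false => //; constructor.
Qed.

(** The disjuncts range over all local configurations and only the actual one, [y0], holds; the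
    disjunction thus decides [P y0]. *)
Lemma beval_bany x (T : finType) (F : T -> bterm Gamma) (P : pred T) (y0 : T) :
  (forall y, beval p s x (F y) (y == y0)) ->
  beval p s x (bany [seq F y | y <- enum T & P y]) (P y0).
Proof.
move=> Fy.
have -> : P y0 = has [pred y | P y && (y == y0)] (enum T).
  apply/idP/hasP => [Py|[y _ /andP[Py /eqP<-]] //].
  by exists y0; rewrite ?mem_enum //= Py eqxx.
elim: (enum T) => [|y l IH] /=; first by constructor.
case: (P y) => //=; case E: (y == y0) (Fy y) => Hy.
  by apply: beval_if_true => //; constructor.
exact: beval_if_false.
Qed.

Lemma beval_char_var x T v c a : ieval p s x T v -> onth s v = Some c ->
  beval p s x (BChar a T) (a == c).
Proof.
move=> Tv sv; have := beval_char a Tv; rewrite sv.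
by rewrite (inj_eq Some_inj) eq_sym.
Qed.

Lemma beval_nextR x r : x < size s ->
  (x.+1 < size s -> beval p s x.+1 (defR r) (r == rstate (drop x.+1 s))) ->
  beval p s x (nextR r) (r == rstate (drop x.+1 s)).
Proof.
move=> xs IH; have := beval_max (ieval_var p s x).
case E: (x == (size s).-1) => Hmax.
  apply: beval_if_true => //; rewrite drop_oversize; last lia.
  by rewrite eq_sym; apply: beval_const.
apply: beval_if_false => //.
apply: (@beval_call_def (inl r) _ _ _ _ (ieval_succ (ieval_var _ _ _))).
have -> : minn x.+1 (size s).-1 = x.+1 by lia.
by apply: IH; lia.
Qed.

Lemma onth_lt x : x < size s -> exists c, onth s x = Some c.
Proof. by rewrite -onthTE; case: (onth s x) => // c _; exists c. Qed.

Lemma rstate_drop x c : onth s x = Some c ->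
  rstate (drop x s) = stepR c (rstate (drop x.+1 s)).
Proof.
move=> sx; have xs : x < size s by rewrite -onthTE sx.
by rewrite (drop_nth c) //= (@onth_nth _ _ _ _ _ sx).
Qed.

Lemma beval_defR x r : x < size s ->
  beval p s x (defR r) (r == rstate (drop x s)).
Proof.
(* Right states are evaluated from the right end towards the left. *)
have [n] := ubnP (size s - x); elim: n x r => // n IH x r xn xs.
have [c sx] := onth_lt xs; rewrite (rstate_drop sx) eq_sym.
apply: (@beval_bany _ _ _ (fun y => stepR y.1 y.2 == r) (c, _)) => -[a r'].
rewrite xpair_eqE; apply: beval_band => /=.
  exact: beval_char_var (ieval_var _ _ _) sx.
by apply: beval_nextR => // xs'; apply: IH => //; lia.
Qed.

Lemma beval_callR x r T v : ieval p s x T v -> v < size s ->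
  beval p s x (callR r T) (r == rstate (drop v s)).
Proof.
move=> Tv vs; apply: (@beval_call_def (inl r) _ _ _ _ Tv).
exact: beval_defR.
Qed.

Notation q0 := (startQ (rstate s)).

Lemma beval_defQ x q : x < size s ->
  beval p s x (defQ q) (q == lstate q0 s x).
Proof.
elim: x q => [|x IH] q xs.
  have Hmin : beval p s 0 (BMin IVar) true := beval_min (ieval_var _ _ _).
  apply: (beval_if_true _ Hmin); rewrite (_ : lstate _ _ _ = q0); last by case: s.
  rewrite eq_sym; apply: (@beval_bany _ _ _ (fun r => startQ r == q)) => r.
  by have := beval_callR r (ieval_var p s 0) xs; rewrite drop0.
have Hmin : beval p s x.+1 (BMin IVar) false := beval_min (ieval_var _ _ _).
apply: (beval_if_false _ Hmin).
have Hpred := ieval_pred (ieval_var p s x.+1).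
have [c sx] := onth_lt (ltnW xs); rewrite (lstateS q0 sx) eq_sym.
apply: (@beval_bany _ _ _ (fun y => stepQ y.1.1 y.1.2 y.2 == q)
  (lstate q0 s x, c, _)) => -[[q' a] r] /=.
rewrite !xpair_eqE -andbA; apply: beval_band.
  by apply: (@beval_call_def (inr q') _ _ _ _ Hpred); apply/IH/ltnW.
by apply: beval_band; [apply: beval_char_var sx|apply: beval_callR (ieval_var _ _ _) _].
Qed.

Lemma beval_head x a i : x < size s ->
  beval p s x (head_term a i) (onth (word_at q0 s x) i == Some a).
Proof.
move=> xs; have [c sx] := onth_lt xs; rewrite /word_at sx.
apply: (@beval_bany _ _ _ (fun y => onth (word y.1.1 y.1.2 y.2) i == Some a)
  (lstate q0 s x, c, _)) => -[[q' b] r] /=.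
rewrite !xpair_eqE -andbA; apply: beval_band.
  apply: (@beval_call_def (inr q') _ _ _ _ (ieval_var _ _ _)).
  exact: beval_defQ.
apply: beval_band; first exact: beval_char_var (ieval_var _ _ _) sx.
by apply: beval_nextR => // ?; apply: beval_defR.
Qed.

End Evaluation.

(** The successor makes the number of copies positive. *)
Definition max_word : nat :=
  (\max_(y : Q * Gamma * R) size (word y.1.1 y.1.2 y.2)).+1.

Lemma size_word_at q s x : size (word_at q s x) <= max_word.
Proof.
rewrite /word_at; case: (onth s x) => // c; apply: leqW.
exact: (@leq_bigmax _ (fun y => size (word y.1.1 y.1.2 y.2))
  (lstate q s x, c, rstate (drop x.+1 s))).
Qed.

Definition bimachine_interpretation : interpretation Sigma Gamma max_word :=
  @Interpretation Sigma Gamma max_word state_scheme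
    (fun a i => head_term a i)
    (fun a i => elimT allP (all_names_head a i)).

Lemma evals_bimachine s x a (i : 'I_max_word) b : x < size s ->
  evals bimachine_interpretation s x a i b <->
  (onth (word_at (startQ (rstate s)) s x) i == Some a) = b.
Proof.
move=> xs; have H := beval_head a i xs; split=> [|<-] //.
exact: beval_functional H.
Qed.

Lemma bimachine_well_defined : well_defined bimachine_interpretation.
Proof.
move=> s i x xs; split=> [a b|b].
  by rewrite !evals_bimachine // => /eqP-> /eqP[].
by rewrite !evals_bimachine // => /negP/negbTE.
Qed.

Lemma pmap_onth_ord (T : Type) (w : seq T) n : size w <= n ->
  pmap (fun i : 'I_n => onth w i) (enum 'I_n) = w.
Proof.
have -> : pmap (fun i : 'I_n => onth w i) (enum 'I_n) =
    pmap (onth w) (iota 0 n).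
  by rewrite -val_enum_ord; elim: (enum _) => //= i l ->.
elim: w n => [|a w IH] [|n] //=.
  by move=> _; elim: (iota 1 n) => //= k l ->; rewrite onth0n.
rewrite ltnS => /IH {2}<-; congr (_ :: _).
by rewrite -[1]addn0 iotaDl; elim: (iota 0 n) => //= k l ->.
Qed.

Lemma bimachine_transduction s :
  transduction bimachine_interpretation s = bioutput (startQ (rstate s)) s.
Proof.
rewrite transductionE bioutputE; congr flatten; apply/eq_in_map => x.
rewrite mem_iota => /= xs; set w := word_at _ _ _.
rewrite -[RHS](pmap_onth_ord (size_word_at _ _ _ : size w <= max_word)).
apply: eq_pmap => i; case: pickP => [a /asboolP|none].
  by rewrite evals_bimachine // => /eqP.
case E: (onth w i) => [a|] //; have := none a.
by rewrite asboolT // evals_bimachine // -/w E eqxx.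
Qed.

End Bimachine.

(** * Rational functions as bimachines *)

Section RationalToBimachine.
Variables (Sigma Gamma : finType) (A : transducer Gamma Sigma).
Variable word : state A -> Gamma -> state A -> seq Sigma.
Hypothesis wordP : forall q c v q',
  @run _ _ A q [:: c] v q' -> @run _ _ A q [:: c] (word q c q') q'.

Definition reads (q : state A) (c : Gamma) (q' : state A) : bool :=
  `[< exists v, @run _ _ A q [:: c] v q' >].

Lemma run_cat q s t q' s' t' q'' :
  @run _ _ A q s t q' -> @run _ _ A q' s' t' q'' ->
  @run _ _ A q (s ++ s') (t ++ t') q''.
Proof.
elim=> {q s t q'} [//|q c v q1 s t q2 e _ IH|q v q1 s t q2 e _ IH] H.
  by rewrite -catA; apply: run_letter e (IH H).
by rewrite -catA; apply: run_eps e (IH H).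
Qed.

Definition alive_step (c : Gamma) (X : {set state A}) : {set state A} :=
  [set q | [exists q' in X, reads q c q']].

Definition pick_next (q : state A) (c : Gamma) (X : {set state A}) :=
  [pick q' in X | reads q c q'].

Definition pick_start (X : {set state A}) := [pick q in initial A :&: X].

(** A left state [None] records that no suitable state could be selected. *)
Definition pick_step (o : option (state A)) c X :=
  obind (fun q => pick_next q c X) o.

Definition pick_word (o : option (state A)) c X : seq Sigma :=
  if o is Some q then
    if pick_next q c X is Some q' then word q c q' else [::]
  else [::].

Notation alive := (rstate (final A) alive_step).
Notation out := (bioutput (final A) alive_step pick_step pick_word).

(** Epsilon transitions are absorbed into the reading of an adjacent letter. The empty word has no
    letter for this: an epsilon run into [final A] may start outside it. *)
Lemma run_alive q s t r :
  @run _ _ A q s t r -> r \in final A -> s != [::] -> q \in alive s.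
Proof.
elim=> {q s t r} [//|q c v q' s t r e H IH|q v q' s t r e H IH] rF.
  move=> _; rewrite inE; case: s H IH => [|c' s] H IH.
    apply/existsP; exists r; rewrite rF; apply/asboolP.
    by exists (v ++ t); apply: run_letter e H.
  apply/existsP; exists q'; rewrite IH //; apply/asboolP.
  by exists (v ++ [::]); apply: run_letter e (run_nil _).
case: s H IH => // c s H /(_ rF isT); rewrite !inE.
move=> /existsP[q2 /andP[q2X /asboolP[w Hw]]] _.
apply/existsP; exists q2; rewrite q2X; apply/asboolP.
by exists (v ++ w); apply: run_eps e Hw.
Qed.

(** Each chosen successor is again alive on the remaining suffix, so the selection never gets
    stuck. *)
Lemma alive_run s q : q \in alive s ->
  exists2 r, r \in final A & @run _ _ A q s (out (Some q) s) r.
Proof.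
elim: s q => [|c s IH] q; first by exists q => //; constructor.
rewrite inE => /existsP[q1 q1P] /=; rewrite /pick_next.
case: pickP => [q2 /andP[q2X /asboolP[v /wordP Hv]]|/(_ q1)]; last by rewrite q1P.
have [r rF Hr] := IH _ q2X; exists r => //.
exact: (run_cat Hv Hr).
Qed.

Lemma realizes_out s t : s != [::] -> realizes A s t ->
  realizes A s (out (pick_start (alive s)) s).
Proof.
move=> s0 [q [r [qI rF H]]]; have qX := run_alive H rF s0.
rewrite /pick_start; case: pickP => [q'|/(_ q)]; last by rewrite inE qI qX.
rewrite inE => /andP[q'I /alive_run[r' r'F H']].
by exists q', r'.
Qed.

End RationalToBimachine.

(** A transduction is total and maps the empty string to itself, so agreement is stated on the
    nonempty strings in the domain of [f]. *)
Lemma rational_interpretation (Sigma Gamma : finType)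
    (f : seq Gamma -> option (seq Sigma)) : rational f ->
  exists (m : nat) (pi : interpretation Sigma Gamma m),
    [/\ 0 < m, well_defined pi
      & forall s : seq Gamma, s <> [::] -> f s <> None ->
          f s = Some (transduction pi s)].
Proof.
case=> A realA.
have /choice[word wordP] (y : state A * Gamma * state A) : exists w, forall v,
    @run _ _ A y.1.1 [:: y.1.2] v y.2 -> @run _ _ A y.1.1 [:: y.1.2] w y.2.
  have [[v Hv]|none] := pselect (exists v, @run _ _ A y.1.1 [:: y.1.2] v y.2).
    by exists v.
  by exists [::] => v Hv; case: none; exists v.
exists _, (bimachine_interpretation (final A) (@alive_step _ _ A)
  (@pick_start _ _ A) (@pick_step _ _ A)
  (pick_word (fun q c q' => word (q, c, q')))).
split=> //; first exact: bimachine_well_defined.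
move=> s /eqP s0; case fs: (f s) => [t|] // _.
(* Whatever [A] realizes on [s] is the value of [f], so the selected run may differ from the one
   that produced [t]. *)
rewrite -fs; apply/realA; rewrite bimachine_transduction.
apply: realizes_out s0 _; last by apply/realA; exact: fs.
by move=> q c v q'; exact: (wordP (q, c, q')).
Qed.

Theorem theorem6 (Sigma Gamma : finType) :
  (forall (m : nat) (pi : interpretation Sigma Gamma m),
     well_defined pi -> rational (fun s => Some (transduction pi s)))
  /\
  (forall f : seq Gamma -> option (seq Sigma), rational f ->
     exists (m : nat) (pi : interpretation Sigma Gamma m),
       [/\ 0 < m, well_defined pi
         & forall s : seq Gamma, s <> [::] -> f s <> None ->
             f s = Some (transduction pi s)]).
Proof.
split; first exact: transduction_rational.
exact: rational_interpretation.
Qed.
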